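(* Let $K$ be a field of characteristic $0$. Let $n_1>n_2>n_3$ be positive integers with $n_1+n_3>2n_2$, and let $a_1,a_2,a_3,a_4\in K$ with $a_1a_2a_3\neq 0$. Put $f(x)=a_1x^{n_1}+a_2x^{n_2}+a_3x^{n_3}+a_4$. Suppose $f(x)=g(h(x))$ with $g,h\in K[x]$, $\deg g\geq 2$, $\deg h\geq 2$, $h$ monic and $h(0)=0$. Then $h(x)=x^k$ and $g(x)=a_1x^{n_1/k}+a_2x^{n_2/k}+a_3x^{n_3/k}+a_4$ for some positive integer $k$ dividing $\gcd(n_1,n_2,n_3)$. *)

(* Defs.v *)
From mathcomp Require Import all_boot all_order all_algebra.
Set Implicit Arguments.
Unset Strict Implicit.
Unset Printing Implicit Defensive.

(* Main.v *)
(**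
If [h] is not [X^k], let [l < k] be the exponent of its second highest term and
[m <= l] that of its lowest one.  With [t = deg g], the coefficient of [g(h)] of
index [(t-1)k + l] is nonzero, because no power [h^i] with [i < t] reaches that
degree; hence [n2 >= (t-1)k + l], and the gap condition gives
[n3 > 2 n2 - n1 >= (t-2)k + 2l >= 2m].  Since [f - a4] vanishes to order
[n3 > 2m] at [0] while [h] vanishes to order exactly [m], the coefficients of
[y] and [y^2] in [g(y)] are zero, so [h^3] divides the trinomial [f - a4].
Then the cube of [h1 = h / X^m] divides it too.  As [h1] is coprime to [X], it
is constant: in characteristic [0], removing powers of [X] and differentiating
twice turns the trinomial into a nonzero monomial still divisible by [h1].
*)
Require Import Defs.
From mathcomp Require Import all_boot all_order all_algebra.
From mathcomp Require Import zify.
Import GRing.Theory.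
Local Open Scope ring_scope.

Lemma poly_eq_mulX_horner0 (R : comNzRingType) (p : {poly R}) :
  exists q : {poly R}, p = q * 'X + p.[0]%:P.
Proof.
have: root (p - p.[0]%:P) 0 by rewrite rootE !hornerE subrr.
case/factor_theorem=> q; rewrite subr0 => def_q.
by exists q; rewrite -def_q subrK.
Qed.

Lemma dvdp_exp_deriv (R : idomainType) (n : nat) (p q : {poly R}) :
  p ^+ n.+1 %| q -> p ^+ n %| q^`().
Proof.
(* Over an integral domain [%|] means divisibility up to a nonzero scalar, here [c], which is
   cleared at the end. *)
case/Pdiv.Idomain.dvdpP => -[c r] /= c_neq0 def_q.
have dvd_r : p ^+ n %| (r * p ^+ n.+1)^`().
  rewrite derivM deriv_exp dvdp_add //; first by rewrite exprS mulrA dvdp_mull.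
  by rewrite dvdp_mull // -mulr_natr dvdp_mulr // dvdp_mull.
by rewrite -(dvdpZr _ _ c_neq0) -derivZ def_q.
Qed.

(** Cancelling ['X^m] leaves a positive power of ['X] dividing [p * q]; as [q] is coprime to ['X],
    that power divides [p]. *)
Lemma horner0_Xn_dvdp (K : fieldType) (p q : {poly K}) (m n : nat) :
  coprimep q 'X -> (m < n)%N -> 'X^n %| p * (q * 'X^m) -> p.[0] = 0.
Proof.
move=> co_qX lt_mn; have -> : n = ((n - m).-1.+1 + m)%N by lia.
rewrite mulrA exprD dvdp_mul2r; last by rewrite -size_poly_eq0 size_polyXn.
rewrite Gauss_dvdpl; last by rewrite coprimep_expl // coprimep_sym.
rewrite exprS => /(dvdp_trans (dvdp_mulr _ (dvdpp _))).
by rewrite -[X in X %| _]subr0 dvdp_XsubCl rootE => /eqP.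
Qed.

(** Each of the two derivatives kills a constant term at the cost of one factor [p], so a cube still
    leaves one factor at the end. *)
Lemma size_cube_dvdp_trinomial (K : fieldType) (charK0 : [pchar K] =i pred0)
    (p : {poly K}) (n1 n2 n3 : nat) (a1 a2 a3 : K) :
    (n3 < n2)%N -> (n2 < n1)%N -> a1 != 0 -> coprimep p 'X ->
    p ^+ 3 %| a1 *: 'X^n1 + a2 *: 'X^n2 + a3 *: 'X^n3 ->
  size p = 1%N.
Proof.
move=> n32 n21 a1_neq0 co_pX.
have natK_neq0 n : (0 < n)%N -> n%:R != 0 :> K.
  by move=> n_gt0; rewrite ((pcharf0P K).1 charK0) -lt0n.
have co_pXn m n : coprimep (p ^+ m) 'X^n.
  by apply: coprimep_expl; apply: coprimep_expr.
set A := (n1 - n3)%N; set B := (n2 - n3)%N.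
have -> : a1 *: 'X^n1 + a2 *: 'X^n2 + a3 *: 'X^n3
    = (a1 *: 'X^A + a2 *: 'X^B + a3%:P) * 'X^n3.
  rewrite !mulrDl -!scalerAl -!exprD mul_polyC.
  by rewrite /A /B !subnK // ?(ltnW n32) // ltnW // (ltn_trans n32).
rewrite Gauss_dvdpl // => /dvdp_exp_deriv.
(* Taking out ['X^(B.-1)], which is coprime to [p], makes the [a2] term constant, ready to vanish
   under the next derivative. *)
have -> : (a1 *: 'X^A + a2 *: 'X^B + a3%:P)^`()
    = ((a1 * A%:R) *: 'X^(A - B) + (a2 * B%:R)%:P) * 'X^(B.-1).
  rewrite !derivD !derivZ !derivXn derivC addr0 mulrDl -scalerAl -exprD.
  rewrite -!scalerA !scaler_nat mul_polyC -scalerA scaler_nat.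
  by congr (_ *: ('X^_ *+ _) + _); lia.
rewrite Gauss_dvdpl // => /dvdp_exp_deriv.
rewrite derivD derivZ derivXn derivC addr0 expr1.
rewrite -scaler_nat scalerA dvdpZr; last first.
  by rewrite !mulf_neq0 ?natK_neq0 //; lia.
(* Now [p] divides a power of ['X] to which it is coprime, so it is coprime to itself. *)
move=> p_dvd; apply/eqP; rewrite -/(coprimep p p) -coprimepp.
by apply: coprimep_dvdl p_dvd _; have := co_pXn 1%N (A - B).-1; rewrite expr1.
Qed.

(** Factor [h ^+ t.+1 - 'X^(k * t.+1)] as [(h - 'X^k) * S]. The cofactor [S] has degree [t * k] and
    leading coefficient [t + 1], nonzero in characteristic 0, so the product has degree exactly
    [t * k + l]. *)
Lemma coef_comp_poly_monic_next (K : fieldType) (charK0 : [pchar K] =i pred0)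
    (g h : {poly K}) (k l t : nat) :
    size h = k.+1 -> size (h - 'X^k) = l.+1 -> (0 < l)%N -> (l < k)%N ->
    h \is monic -> size g = t.+2 ->
  (g \Po h)`_(t * k + l) != 0.
Proof.
move=> size_h size_q l_gt0 lt_lk h_monic size_g.
(* For [i <= t] the degree of [h ^+ i] is at most [t * k < t * k + l], so only the top term of [g]
   contributes. *)
rewrite coef_comp_poly size_g big_ord_recr /= big1 ?add0r; last first.
  move=> [i /= lt_it] _; rewrite [X in _ * X]nth_default ?mulr0 //.
  apply: (leq_trans (size_poly_exp_leq h i)); rewrite size_h /=; nia.
have g_lead : g`_t.+1 != 0.
  by rewrite -[t.+1]/(t.+2.-1) -size_g -lead_coefE lead_coef_eq0
    -size_poly_gt0 size_g.
rewrite mulf_neq0 //.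
set S := \sum_(i < t.+1) h ^+ (t.+1.-1 - i) * 'X^k ^+ i.
have size_hX m : size (h ^+ m) = (k * m).+1.
  have := size_exp h m; rewrite size_h /= => <-; rewrite prednK //.
  by rewrite size_poly_gt0 monic_neq0 // monic_exp.
have hexpE : h ^+ t.+1 = 'X^(k * t.+1) + (h - 'X^k) * S.
  by rewrite -subrXX -exprM addrC subrK.
(* All [t + 1] summands of [S] are monic of degree [t * k]. *)
have S_coef : S`_(t * k) = t.+1%:R.
  rewrite coef_sum (eq_bigr (fun=> 1)) ?sumr_const ?card_ord // => -[i lt_it] _.
  rewrite -exprM coefMXn /= ifF; last by nia.
  have -> : (t * k - k * i = (size (h ^+ (t - i))).-1)%N.
    by rewrite size_hX /=; nia.
  by rewrite -lead_coefE (monicP _) // monic_exp.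
have tK_neq0 : t.+1%:R != 0 :> K by rewrite ((pcharf0P K).1 charK0).
have size_S : size S = (t * k).+1.
  apply/eqP; rewrite eqn_leq; apply/andP; split; last first.
    by rewrite ltnNge; apply: contra tK_neq0 => ?; rewrite -S_coef nth_default.
  apply: (leq_trans (size_sum _ _ _)); apply/bigmax_leqP => -[i lt_it] _ /=.
  rewrite -exprM (leq_trans (size_polyMleq _ _)) // size_hX size_polyXn; nia.
have /negPf neq_kt : (t * k + l != k * t.+1)%N by nia.
rewrite hexpE coefD coefXn neq_kt add0r.
have -> : (t * k + l = (size ((h - 'X^k) * S)%R).-1)%N.
  by rewrite size_mul -?size_poly_gt0 ?size_q ?size_S //; lia.
rewrite -lead_coefE lead_coef_eq0.
by rewrite mulf_neq0 // -size_poly_gt0 ?size_q ?size_S.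
Qed.

Theorem theorem5p4 (K : fieldType) (charK0 : [pchar K] =i pred0)
    (n1 n2 n3 : nat)
    (n3_gt0 : (0 < n3)%N) (n32 : (n3 < n2)%N) (n21 : (n2 < n1)%N)
    (n_gap : (2 * n2 < n1 + n3)%N)
    (a1 a2 a3 a4 : K) (a123_neq0 : a1 * a2 * a3 != 0)
    (f g h : {poly K})
    (f_def : f = a1 *: 'X^n1 + a2 *: 'X^n2 + a3 *: 'X^n3 + a4%:P)
    (f_comp : f = g \Po h)
    (deg_g : (2 <= (size g).-1)%N) (deg_h : (2 <= (size h).-1)%N)
    (h_monic : h \is monic) (h_at0 : h.[0] = 0) :
  exists k : nat,
    [/\ (0 < k)%N, (k %| gcdn n1 (gcdn n2 n3))%N, h = 'X^k &
        g = a1 *: 'X^(n1 %/ k) + a2 *: 'X^(n2 %/ k)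
            + a3 *: 'X^(n3 %/ k) + a4%:P].
Proof.
move: a123_neq0; rewrite !mulf_eq0 !negb_or -andbA.
case/and3P=> a1_neq0 a2_neq0 a3_neq0.
have fE i : f`_i = a1 * (i == n1)%:R + a2 * (i == n2)%:R + a3 * (i == n3)%:R
    + (if i == 0%N then a4 else 0).
  by rewrite f_def !coefD !coefZ !coefXn coefC.
have f_n1 : f`_n1 = a1.
  have [/negPf n12 /negPf n13 /negPf n10] : [/\ n1 != n2, n1 != n3 & n1 != 0]%N.
    by split; lia.
  by rewrite fE eqxx n12 n13 n10 !mulr0 !addr0 mulr1.
have f_n2 : f`_n2 = a2.
  have [/negPf n21' /negPf n23 /negPf n20] :
      [/\ n2 != n1, n2 != n3 & n2 != 0]%N.
    by split; lia.
  by rewrite fE eqxx n21' n23 n20 !mulr0 !addr0 add0r mulr1.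
have f_n3 : f`_n3 = a3.
  have [/negPf n31 /negPf n32' /negPf n30] :
      [/\ n3 != n1, n3 != n2 & n3 != 0]%N.
    by split; lia.
  by rewrite fE eqxx n31 n32' n30 !mulr0 addr0 !add0r mulr1.
have f_0 : f`_0 = a4.
  have [/negPf n01 /negPf n02 /negPf n03] : [/\ 0 != n1, 0 != n2 & 0 != n3]%N.
    by split; lia.
  by rewrite fE eqxx n01 n02 n03 !mulr0 !add0r.
have f_gap j : [&& j != n1, j != n2, j != n3 & j != 0]%N -> f`_j = 0.
  case/and4P=> /negPf j1 /negPf j2 /negPf j3 /negPf j0.
  by rewrite fE j1 j2 j3 j0 !mulr0 !addr0.
set k := (size h).-1 in deg_h *.
(* This [t] is [deg g - 1], one less than the [t] of the overview: the index [(t-1)k + l] there is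
   [t * k + l] here. *)
set t := (size g).-2.
have size_h : size h = k.+1 by lia.
have size_g : size g = t.+2 by lia.
have t_gt0 : (0 < t)%N by rewrite /t -ltnS; lia.
have size_f : size f = n1.+1.
  apply/eqP; rewrite eqn_leq; apply/andP; split.
    by apply/leq_sizeP => j lt_j; apply: f_gap; lia.
  by rewrite ltnNge; apply: contra a1_neq0 => ?; rewrite -f_n1 nth_default.
have def_n1 : n1 = (t.+1 * k)%N.
  by have := size_comp_poly g h; rewrite -f_comp size_f size_g size_h.
have k_gt0 : (0 < k)%N by lia.
have [def_h | h_neqXk] := eqVneq h 'X^k.
  (* A polynomial in ['X^k] has nonzero coefficients only at multiples of [k]. *)
  have coef_k n : f`_n != 0 -> (k %| n)%N.
    by rewrite f_comp def_h coef_comp_poly_Xn //; case: ifP; rewrite ?eqxx.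
  have [k1 k2 k3] : [/\ k %| n1, k %| n2 & k %| n3]%N.
    by split; apply: coef_k; rewrite ?f_n1 ?f_n2 ?f_n3.
  exists k; split; rewrite ?dvdn_gcd ?k1 ?k2 //.
  apply/polyP => i; have := congr1 (fun p : {poly K} => p`_(k * i)) f_comp.
  rewrite /= fE def_h coef_comp_poly_Xn // dvdn_mulr // mulKn // => <-.
  rewrite !coefD !coefZ !coefXn coefC.
  case/dvdnP: k1 => m1 ->; case/dvdnP: k2 => m2 ->; case/dvdnP: k3 => m3 ->.
  rewrite !mulnK // !(mulnC _ k) !eqn_pmul2l //.
  by rewrite muln_eq0 (gtn_eqF k_gt0).
exfalso.
set q := h - 'X^k.
have q_neq0 : q != 0 by rewrite subr_eq0.
have [m [h1]] := multiplicity_XsubC h 0.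
rewrite subr0 monic_neq0 //= => h1_0 def_h.
have size_q_le : (size q <= k)%N.
  apply/leq_sizeP => j; rewrite leq_eqVlt => /predU1P[<- | lt_kj].
    by rewrite coefB coefXn eqxx -lead_coefE (monicP h_monic) subrr.
  by rewrite coefB coefXn nth_default ?size_h // gtn_eqF ?subrr.
have m_gt0 : (0 < m)%N.
  rewrite lt0n; apply: contra h1_0 => /eqP m0.
  by move: h_at0; rewrite def_h m0 expr0 mulr1 => /rootP.
have h1_neq0 : h1 != 0 by apply: contra h1_0 => /eqP->; rewrite root0.
have size_h_m : (size h1 + m = k.+1)%N.
  by rewrite -size_h def_h size_mulXn // addnC.
have h1_gt0 : (0 < size h1)%N by rewrite size_poly_gt0.
(* Since [m <= k], ['X^m] divides both [h] and ['X^k]; this yields [m <= l], and then [0 < l]. *)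
have Xm_q : 'X^m %| q.
  by rewrite dvdp_sub // ?def_h ?dvdp_mull // dvdp_exp2l // -ltnS -size_h_m
    -add1n leq_add2r.
have lt_mq : (m < size q)%N.
  by have := dvdp_leq q_neq0 Xm_q; rewrite size_polyXn.
set l := (size q).-1.
have size_q : size q = l.+1 by rewrite prednK // (leq_trans _ lt_mq).
have le_ml : (m <= l)%N by rewrite -ltnS -size_q.
have l_gt0 : (0 < l)%N by apply: leq_trans le_ml.
have lt_lk : (l < k)%N by rewrite -size_q.
have := coef_comp_poly_monic_next K charK0 g h k l t size_h size_q l_gt0 lt_lk
  h_monic size_g.
rewrite -f_comp => f_N.
(* The index lies strictly between [0] and [n1 = t.+1 * k], so a nonzero coefficient there forces it
   to be [n2] or [n3]. *)
have le_N_n2 : (t * k + l <= n2)%N.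
  rewrite leqNgt; apply/negP => lt_n2.
  by move/eqP: f_N; apply; apply: f_gap;
    clear -n32 lt_n2 lt_lk def_n1; nia.
have lt_2m_n3 : (2 * m < n3)%N.
  by clear -n_gap le_N_n2 le_ml t_gt0 def_n1; nia.
(* The coefficients of [g] at ['X] and ['X^2] are [g1.[0]] and [g2.[0]]; once both vanish, [g -
   g.[0]%:P] is [g3 * 'X^3]. *)
have [g1 def_g] := poly_eq_mulX_horner0 K g.
have [g2 def_g1] := poly_eq_mulX_horner0 K g1.
have [g3 def_g2] := poly_eq_mulX_horner0 K g2.
have comp_h0 p : (p \Po h).[0] = p.[0] by rewrite horner_comp h_at0.
have def_P : a1 *: 'X^n1 + a2 *: 'X^n2 + a3 *: 'X^n3 = (g1 \Po h) * h.
  have g0 : g.[0] = a4.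
    by rewrite -comp_h0 -f_comp horner_coef0.
  apply: (addIr a4%:P); rewrite -f_def f_comp {1}def_g g0.
  by rewrite comp_polyD comp_polyM comp_polyX comp_polyC.
have lt_m_n3 : (m < n3)%N.
  by rewrite (leq_ltn_trans _ lt_2m_n3) // leq_pmull.
have Xn3_P : 'X^n3 %| (g1 \Po h) * h.
  rewrite -def_P !dvdp_add // dvdpZr // dvdp_exp2l // ltnW //.
  exact: ltn_trans n21.
have co_h1X : coprimep h1 'X by rewrite -(subr0 'X) coprimep_XsubC.
(* The order of vanishing at [0] kills one coefficient of [g] at a time. *)
have g1_0 : g1.[0] = 0.
  rewrite -comp_h0; apply: (horner0_Xn_dvdp K _ h1 m n3) => //.
  by rewrite -def_h.
have def_P2 : (g1 \Po h) * h = (g2 \Po h) * h ^+ 2.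
  by rewrite {1}def_g1 g1_0 addr0 comp_polyM comp_polyX -mulrA.
have g2_0 : g2.[0] = 0.
  rewrite -comp_h0; apply: (horner0_Xn_dvdp K _ (h1 ^+ 2) (2 * m) n3) => //.
    exact: coprimep_expl.
  by rewrite mulnC exprM -exprMn -def_h -def_P2.
have def_P3 : (g2 \Po h) * h ^+ 2 = (g3 \Po h) * h ^+ 3.
  by rewrite {1}def_g2 g2_0 addr0 comp_polyM comp_polyX -mulrA.
have h1_cube : h1 ^+ 3 %| a1 *: 'X^n1 + a2 *: 'X^n2 + a3 *: 'X^n3.
  by rewrite def_P def_P2 def_P3 dvdp_mull // def_h exprMn dvdp_mulr.
have size_h1 := size_cube_dvdp_trinomial K charK0 h1 n1 n2 n3 a1 a2 a3 n32 n21
  a1_neq0 co_h1X h1_cube.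
(* With [h1] constant, monicity of [h] makes it [1] and the degree gives [m = k], so [h = 'X^k], a
   contradiction. *)
move/eqP: h_neqXk; apply; move: h_monic; rewrite def_h monicMr ?monicXn //.
have /eqP/size_poly1P[c _ def_h1] := size_h1.
rewrite def_h1 monicE lead_coefC => /eqP ->; rewrite mul1r.
by have -> : m = k by move: size_h_m; rewrite size_h1 => -[].
Qed.
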